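(* Let $a,b$ be real numbers with $0<a<b$, let $q>1$ and let $p$ satisfy $\frac1p+\frac1q=1$. Then $$\left|-\ln I(a,b)+\frac{\ln\left(a^{b}/b^{a}\right)}{2(b-a)}+\frac12\ln A(a,b)\right|\le\frac{1}{4^{1+1/q}}L_{p}(a,b)\left[\bigl(b^{-q}+3a^{-q}\bigr)^{1/q}+\bigl(a^{-q}+3b^{-q}\bigr)^{1/q}\right].$$
   Context: For $0<a<b$: $A(a,b)=\frac{a+b}{2}$ (arithmetic mean), $I(a,b)=\frac1e\left(\frac{b^{b}}{a^{a}}\right)^{\frac{1}{b-a}}$ (identric mean), and $L_{p}(a,b)=\left(\frac{b^{p+1}-a^{p+1}}{(p+1)(b-a)}\right)^{1/p}$ for real $p\neq-1,0$ (generalized logarithmic mean). *)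

(* Defs.v *)
From Stdlib Require Import Reals.
Open Scope R_scope.

(* [Rpower x y] is [exp (y * ln x)], i.e. the real power x^y only for 0 < x.
   For 0 < a < b every base below is positive; in [log_mean] this holds
   because b^(p+1) - a^(p+1) and p + 1 have the same sign. *)

Definition arith_mean (a b : R) : R := (a + b) / 2.

Definition identric_mean (a b : R) : R :=
  1 / exp 1 * Rpower (Rpower b b / Rpower a a) (1 / (b - a)).

(* Generalized logarithmic mean; meaningful for p <> -1 and p <> 0. *)
Definition log_mean (p a b : R) : R :=
  Rpower ((Rpower b (p + 1) - Rpower a (p + 1)) / ((p + 1) * (b - a))) (1 / p).

(* Main.v *)
Require Import Defs.
From Stdlib Require Import Reals Lra.
From Coquelicot Require Import Coquelicot.
Open Scope R_scope.

(** With [x = a + s (b - a) / 2], the quantity inside the absolute value is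
    minus a quarter of
    [∫_0^1 (b + s (a - b)) / (a + s (b - a) / 2) ds] plus the same integral with
    [a] and [b] exchanged. Hölder's inequality bounds each integral by
    [L_p(a,b) * (∫_0^1 x^(-q) ds)^(1/q)], and the convexity of [x^(-q)] on
    [[a, (a + b) / 2]] bounds the last integral by [(3 a^(-q) + b^(-q)) / 4]. *)

(** * Convexity of the exponential and of negative powers *)

Lemma exp_convex (t x y : R) :
  0 <= t <= 1 ->
  exp (t * x + (1 - t) * y) <= t * exp x + (1 - t) * exp y.
Proof.
  intros Ht.
  set (m := t * x + (1 - t) * y).
  assert (tangent : forall z, exp m * (1 + (z - m)) <= exp z).
  { intros z. replace (exp z) with (exp m * exp (z - m)).
    - apply Rmult_le_compat_l; [left; apply exp_pos | apply exp_ineq1_le].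
    - rewrite <- exp_plus. f_equal. ring. }
  assert (Hx := Rmult_le_compat_l t _ _ ltac:(lra) (tangent x)).
  assert (Hy := Rmult_le_compat_l (1 - t) _ _ ltac:(lra) (tangent y)).
  (* Weighted by [t] and [1 - t], the linear terms of the two tangent bounds cancel, since [m] is
     the weighted mean of [x] and [y]. *)
  replace (exp m) with
    (t * (exp m * (1 + (x - m))) + (1 - t) * (exp m * (1 + (y - m))))
    by (unfold m; ring).
  lra.
Qed.

Lemma Rpower_gt_0 (x y : R) : 0 < Rpower x y.
Proof. apply exp_pos. Qed.

(** The inequality [1 + z <= exp z] is used twice: it gives [(x/m)^(-q) >= 1 - q ln (x/m)], and also
    [ln (x/m) <= x/m - 1]. Scaling by [m^(-q)] yields the tangent at [m]. *)
Lemma Rpower_neg_tangent (q m x : R) :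
  0 <= q -> 0 < m -> 0 < x ->
  Rpower m (- q) * (1 - q * (x / m - 1)) <= Rpower x (- q).
Proof.
  intros Hq Hm Hx.
  assert (Hxm : 0 < x / m) by (apply Rdiv_lt_0_compat; lra).
  replace (Rpower x (- q)) with (Rpower m (- q) * Rpower (x / m) (- q)).
  2:{ rewrite Rpower_mult_distr by assumption. f_equal. field. lra. }
  apply Rmult_le_compat_l; [left; apply exp_pos |].
  assert (Hexp := exp_ineq1_le (- q * ln (x / m))).
  assert (Hln := exp_ineq1_le (ln (x / m))).
  rewrite exp_ln in Hln by assumption.
  unfold Rpower. nra.
Qed.

Lemma Rpower_neg_convex (q t x y : R) :
  0 <= q -> 0 < x -> 0 < y -> 0 <= t <= 1 ->
  Rpower (t * x + (1 - t) * y) (- q)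
  <= t * Rpower x (- q) + (1 - t) * Rpower y (- q).
Proof.
  intros Hq Hx Hy Ht.
  set (m := t * x + (1 - t) * y).
  assert (Hm : 0 < m).
  { unfold m. destruct (Req_dec t 0) as [-> | Hne]; [lra | nra]. }
  assert (Tx := Rmult_le_compat_l t _ _ ltac:(lra)
                  (Rpower_neg_tangent q m x Hq Hm Hx)).
  assert (Ty := Rmult_le_compat_l (1 - t) _ _ ltac:(lra)
                  (Rpower_neg_tangent q m y Hq Hm Hy)).
  set (M := Rpower m (- q)) in *.
  replace M with
    (t * (M * (1 - q * (x / m - 1))) + (1 - t) * (M * (1 - q * (y / m - 1)))).
  - lra.
  - replace y with ((m - t * x) + t * y) by (unfold m; ring).
    unfold m in Hm |- *. field. lra.
Qed.

(** * Young's and Hölder's inequalities *)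

Section Hoelder.

Variables p q : R.
Hypotheses (Hp : 0 < p) (Hq : 0 < q) (Hpq : / p + / q = 1).

(** Convexity of the exponential at [p ln x] and [q ln y], with the conjugate weights [1/p] and
    [1/q]. *)
Lemma young (x y : R) :
  0 < x -> 0 < y -> x * y <= Rpower x p / p + Rpower y q / q.
Proof.
  intros Hx Hy.
  assert (Hp' := Rinv_0_lt_compat p Hp).
  assert (Hq' := Rinv_0_lt_compat q Hq).
  assert (H := exp_convex (/ p) (p * ln x) (q * ln y) ltac:(lra)).
  replace (1 - / p) with (/ q) in H by lra.
  replace (/ p * (p * ln x) + / q * (q * ln y)) with (ln x + ln y) in H
    by (field; lra).
  rewrite exp_plus, !exp_ln in H by assumption.
  unfold Rpower. lra.
Qed.

(** Young's inequality is applied pointwise to [f / U] and [g / V], then integrated. The majorant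
    [h] lets [G] be the integral of a chord above [g^q], so that [g^q] itself is never
    integrated. *)
Lemma is_RInt_hoelder (f g h : R -> R) (a b F G I : R) :
  a <= b ->
  (forall x, a < x < b -> 0 < f x /\ 0 < g x) ->
  (forall x, a < x < b -> Rpower (g x) q <= h x) ->
  0 < F -> 0 < G ->
  is_RInt (fun x => Rpower (f x) p) a b F ->
  is_RInt h a b G ->
  is_RInt (fun x => f x * g x) a b I ->
  I <= Rpower F (1 / p) * Rpower G (1 / q).
Proof.
  intros Hab Hpos Hgh HF HG IF IG II.
  set (U := Rpower F (1 / p)). set (V := Rpower G (1 / q)).
  assert (HU : 0 < U) by apply exp_pos.
  assert (HV : 0 < V) by apply exp_pos.
  assert (scaled : forall z Z r, 0 < z -> 0 < Z -> 0 < r ->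
            Rpower (z / Rpower Z (1 / r)) r = Rpower z r / Z).
  { intros z Z r Hz HZ Hr.
    assert (HZr := Rpower_gt_0 Z (1 / r)).
    apply (Rmult_eq_reg_r Z); [| lra].
    replace Z with (Rpower (Rpower Z (1 / r)) r) at 2.
    - rewrite Rpower_mult_distr; [| apply Rdiv_lt_0_compat; lra | lra].
      replace (z / Rpower Z (1 / r) * Rpower Z (1 / r)) with z by (field; lra).
      field; lra.
    - rewrite Rpower_mult. replace (1 / r * r) with 1 by (field; lra).
      apply Rpower_1. assumption. }
  (* This integrand is [U * V] times the right side of Young's inequality, with [h] in place of
     [g^q]; its integral is [U * V * (1/p + 1/q)]. *)
  assert (bound : is_RInt
    (fun x => plus (scal (U * V / (p * F)) (Rpower (f x) p))
                   (scal (U * V / (q * G)) (h x))) a b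
    (plus (scal (U * V / (p * F)) F) (scal (U * V / (q * G)) G))).
  { apply @is_RInt_plus; apply @is_RInt_scal; assumption. }
  replace (U * V) with
    (plus (scal (U * V / (p * F)) F) (scal (U * V / (q * G)) G)).
  2:{ change (U * V / (p * F) * F + U * V / (q * G) * G = U * V).
      transitivity (U * V * (/ p + / q)); [field; lra | rewrite Hpq; ring]. }
  apply (is_RInt_le _ _ _ _ _ _ Hab II bound).
  intros x Hx.
  destruct (Hpos x Hx) as [Hf Hg].
  assert (Y := young (f x / U) (g x / V)
                 ltac:(apply Rdiv_lt_0_compat; assumption)
                 ltac:(apply Rdiv_lt_0_compat; assumption)).
  unfold U, V in Y. rewrite !scaled in Y by assumption. fold U V in Y.
  assert (HUV : 0 < U * V) by (apply Rmult_lt_0_compat; assumption).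
  apply (Rmult_le_compat_l _ _ _ (Rlt_le _ _ HUV)) in Y.
  replace (U * V * (f x / U * (g x / V))) with (f x * g x) in Y
    by (field; lra).
  change (f x * g x <=
    U * V / (p * F) * Rpower (f x) p + U * V / (q * G) * h x).
  refine (Rle_trans _ _ _ Y _).
  replace (U * V * (Rpower (f x) p / F / p + Rpower (g x) q / G / q)) with
    (U * V / (p * F) * Rpower (f x) p + U * V / (q * G) * Rpower (g x) q)
    by (field; lra).
  apply Rplus_le_compat_l, Rmult_le_compat_l; [| apply Hgh, Hx].
  left. apply Rdiv_lt_0_compat; [| apply Rmult_lt_0_compat]; assumption.
Qed.

End Hoelder.

(** * Closed forms and bounds for the integrals *)

Lemma affine_pos (a b s : R) : 0 < a -> 0 < b -> 0 <= s <= 1 -> 0 < a + s * (b - a).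
Proof. intros. destruct (Req_dec s 0) as [-> | Hne]; [lra | nra]. Qed.

Lemma is_RInt_Rpower_affine (p a b : R) :
  p + 1 <> 0 -> 0 < a -> 0 < b -> a <> b ->
  is_RInt (fun s => Rpower (a + s * (b - a)) p) 0 1
    ((Rpower b (p + 1) - Rpower a (p + 1)) / ((p + 1) * (b - a))).
Proof.
  intros Hp Ha Hb Hab.
  set (F := fun s => Rpower (a + s * (b - a)) (p + 1) / ((p + 1) * (b - a))).
  replace ((Rpower b (p + 1) - Rpower a (p + 1)) / ((p + 1) * (b - a)))
    with (minus (F 1) (F 0)).
  2:{ change (F 1 - F 0 =
        (Rpower b (p + 1) - Rpower a (p + 1)) / ((p + 1) * (b - a))).
      unfold F. replace (a + 1 * (b - a)) with b by ring.
      replace (a + 0 * (b - a)) with a by ring. field; lra. }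
  apply (is_RInt_derive F);
    rewrite Rmin_left, Rmax_right by lra; intros s Hs;
    assert (Hx := affine_pos a b s Ha Hb Hs).
  - unfold F, Rpower. auto_derive; [lra |].
    replace ((p + 1) * ln (a + s * (b - a)))
      with (p * ln (a + s * (b - a)) + ln (a + s * (b - a))) by ring.
    rewrite exp_plus, exp_ln by lra. field; lra.
  - apply @ex_derive_continuous. unfold Rpower. auto_derive. lra.
Qed.

Lemma is_RInt_affine (c d : R) :
  is_RInt (fun s => c + s * d) 0 1 (c + d / 2).
Proof.
  set (F := fun s : R => c * s + s * s * d / 2).
  replace (c + d / 2) with (minus (F 1) (F 0)).
  2:{ change (F 1 - F 0 = c + d / 2). unfold F. field. }
  apply (is_RInt_derive F); intros s _.
  - unfold F. auto_derive; [trivial | field].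
  - apply @ex_derive_continuous. auto_derive. trivial.
Qed.

(** With [x = a + s (b - a) / 2], the integrand [(b + s (a - b)) / x] equals [(2 a + b) / x - 2],
    which integrates over [0, 1] to this value. *)
Definition half_integral (a b : R) : R :=
  (2 * a + b) * (2 / (b - a)) * (ln ((a + b) / 2) - ln a) - 2.

(** Assuming [a <> b] instead of an order makes the exchanged integral an instance. The denominator
    is written as a path from [a] to the midpoint, the form that [affine_pos] handles. *)
Lemma is_RInt_half_integral (a b : R) :
  0 < a -> 0 < b -> a <> b ->
  is_RInt (fun s => (b + s * (a - b)) * / (a + s * ((a + b) / 2 - a))) 0 1
    (half_integral a b).
Proof.
  intros Ha Hb Hab.
  set (F := fun s =>
    (2 * a + b) * (2 / (b - a)) * ln (a + s * ((a + b) / 2 - a)) - 2 * s).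
  replace (half_integral a b) with (minus (F 1) (F 0)).
  2:{ change (F 1 - F 0 = half_integral a b). unfold F, half_integral.
      replace (a + 1 * ((a + b) / 2 - a)) with ((a + b) / 2) by ring.
      replace (a + 0 * ((a + b) / 2 - a)) with a by ring. field; lra. }
  apply (is_RInt_derive F);
    rewrite Rmin_left, Rmax_right by lra; intros s Hs;
    assert (Hx := affine_pos a ((a + b) / 2) s Ha ltac:(lra) Hs).
  - unfold F. auto_derive; [lra |]. field. repeat split; lra.
  - apply @ex_derive_continuous. auto_derive. lra.
Qed.

Lemma half_integral_ge_0 (a b : R) :
  0 < a -> 0 < b -> a <> b -> 0 <= half_integral a b.
Proof.
  intros Ha Hb Hab.
  assert (I := is_RInt_half_integral a b Ha Hb Hab).
  apply (is_RInt_ge_0 _ 0 1 _ ltac:(lra) I).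
  intros s Hs. left. apply Rmult_lt_0_compat; [| apply Rinv_0_lt_compat];
    apply affine_pos; lra.
Qed.

Lemma log_mean_base_pos (p a b : R) :
  0 < p + 1 -> 0 < a -> a < b ->
  0 < (Rpower b (p + 1) - Rpower a (p + 1)) / ((p + 1) * (b - a)).
Proof.
  intros Hp Ha Hab.
  assert (H := Rlt_Rpower_l a b (p + 1) Hp (conj Ha Hab)).
  apply Rdiv_lt_0_compat; [lra | apply Rmult_lt_0_compat; lra].
Qed.

Lemma log_mean_base_sym (p a b : R) :
  p + 1 <> 0 -> a <> b ->
  (Rpower a (p + 1) - Rpower b (p + 1)) / ((p + 1) * (a - b)) =
  (Rpower b (p + 1) - Rpower a (p + 1)) / ((p + 1) * (b - a)).
Proof. intros. field. repeat split; lra. Qed.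

Lemma half_integral_le (p q a b : R) :
  0 < p -> 0 < q -> / p + / q = 1 -> 0 < a -> 0 < b -> a <> b ->
  half_integral a b <=
  log_mean p a b *
  Rpower ((Rpower b (- q) + 3 * Rpower a (- q)) / 4) (1 / q).
Proof.
  intros Hp Hq Hpq Ha Hb Hab.
  assert (HA := Rpower_gt_0 a (- q)). assert (HB := Rpower_gt_0 b (- q)).
  set (A := Rpower a (- q)) in *. set (B := Rpower b (- q)) in *.
  (* The factor [f] below runs from [b] to [a], so the base of the mean is put in that
     orientation. *)
  unfold log_mean. rewrite <- log_mean_base_sym by lra.
  apply is_RInt_hoelder with (a := 0) (b := 1)
    (f := fun s => b + s * (a - b))
    (g := fun s => / (a + s * ((a + b) / 2 - a)))
    (h := fun s => A + s * ((B - A) / 2)); try lra.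
  - intros s Hs. split; [| apply Rinv_0_lt_compat]; apply affine_pos; lra.
  - intros s Hs.
    assert (Hx : 0 < a + s * ((a + b) / 2 - a)) by (apply affine_pos; lra).
    (* The path only reaches the midpoint, so [b] has weight [s / 2]. The majorant is the chord
       between [a] and [b], and its mean over [0, 1] is [A + (B - A) / 4]. *)
    assert (H := Rpower_neg_convex q (s / 2) b a ltac:(lra) Hb Ha ltac:(lra)).
    replace (s / 2 * b + (1 - s / 2) * a)
      with (a + s * ((a + b) / 2 - a)) in H by field.
    fold A B in H. unfold Rpower at 1. rewrite ln_Rinv by assumption.
    replace (q * - ln (a + s * ((a + b) / 2 - a)))
      with (- q * ln (a + s * ((a + b) / 2 - a))) by ring.
    unfold Rpower in H. lra.
  - destruct (Rlt_or_le a b).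
    + rewrite log_mean_base_sym by lra. apply log_mean_base_pos; lra.
    + apply log_mean_base_pos; lra.
  - apply is_RInt_Rpower_affine; lra.
  - replace ((B + 3 * A) / 4) with (A + (B - A) / 2 / 2) by field.
    apply is_RInt_affine.
  - apply is_RInt_half_integral; assumption.
Qed.

(** * From the integrals back to the means *)

Lemma ln_identric_mean (a b : R) :
  ln (identric_mean a b) = (b * ln b - a * ln a) / (b - a) - 1.
Proof.
  unfold identric_mean, Rpower, Rdiv.
  rewrite Rmult_1_l, <- !exp_Ropp, <- !exp_plus, !ln_exp. ring.
Qed.

Theorem proposition6 (a b p q : R) (ha : 0 < a) (hab : a < b) (hq : 1 < q)
    (hpq : 1 / p + 1 / q = 1) :
  Rabs (- ln (identric_mean a b)
        + ln (Rpower a b / Rpower b a) / (2 * (b - a))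
        + 1 / 2 * ln (arith_mean a b))
  <= 1 / Rpower 4 (1 + 1 / q) * log_mean p a b
     * (Rpower (Rpower b (- q) + 3 * Rpower a (- q)) (1 / q)
        + Rpower (Rpower a (- q) + 3 * Rpower b (- q)) (1 / q)).
Proof.
  assert (Hpq : / p + / q = 1) by (unfold Rdiv in hpq; lra).
  assert (Hq : / q < 1) by (rewrite <- Rinv_1; apply Rinv_lt_contravar; lra).
  assert (Hp : 0 < p).
  { rewrite <- (Rinv_inv p). apply Rinv_0_lt_compat. lra. }
  (* In the sum of the two closed forms the logarithm of the midpoint has coefficient
     [2 (a - b) / (b - a) = -2], and the constants add up to -4, matching the [1] in [- ln I]. *)
  assert (E : - ln (identric_mean a b)
        + ln (Rpower a b / Rpower b a) / (2 * (b - a))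
        + 1 / 2 * ln (arith_mean a b)
      = - ((half_integral a b + half_integral b a) / 4)).
  { rewrite ln_identric_mean.
    rewrite ln_div by apply Rpower_gt_0. unfold Rpower. rewrite !ln_exp.
    unfold arith_mean, half_integral. rewrite (Rplus_comm b a).
    field. lra. }
  rewrite E, Rabs_Ropp.
  assert (H1 := half_integral_ge_0 a b ha ltac:(lra) ltac:(lra)).
  assert (H2 := half_integral_ge_0 b a ltac:(lra) ha ltac:(lra)).
  rewrite Rabs_pos_eq by lra.
  assert (K1 := half_integral_le p q a b Hp ltac:(lra) Hpq ha
                  ltac:(lra) ltac:(lra)).
  assert (K2 := half_integral_le p q b a Hp ltac:(lra) Hpq
                  ltac:(lra) ha ltac:(lra)).
  assert (Lsym : log_mean p b a = log_mean p a b).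
  { unfold log_mean. rewrite log_mean_base_sym by lra. reflexivity. }
  rewrite Lsym in K2.
  (* The factor [4^(-1/q)] from the averaged chord joins the factor [1/4] from [E] to give
     [1 / 4^(1 + 1/q)]. *)
  assert (quarter : forall x, 0 < x ->
            Rpower (x / 4) (1 / q) = Rpower x (1 / q) / Rpower 4 (1 / q)).
  { intros x Hx. unfold Rdiv at 1 3.
    rewrite <- Rpower_mult_distr by lra. f_equal.
    rewrite <- Rpower_Ropp. unfold Rpower. rewrite ln_Rinv by lra.
    f_equal. ring. }
  assert (HA := Rpower_gt_0 a (- q)). assert (HB := Rpower_gt_0 b (- q)).
  rewrite quarter in K1, K2 by lra.
  rewrite Rpower_plus, Rpower_1 by lra.
  assert (H4 := Rpower_gt_0 4 (1 / q)).
  match goal with |- _ <= ?r => replace r with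
    ((log_mean p a b * (Rpower (Rpower b (- q) + 3 * Rpower a (- q)) (1 / q)
        / Rpower 4 (1 / q))
      + log_mean p a b * (Rpower (Rpower a (- q) + 3 * Rpower b (- q)) (1 / q)
        / Rpower 4 (1 / q))) / 4) by (field; lra) end.
  lra.
Qed.
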